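(* Let $D$ be a domain of finite character such that, for each maximal ideal $M$ of $D$, the localization $D_M$ is a valuation domain whose value group is a complete subgroup of the reals. Then $D$ is a sharp domain.
   Context: All rings are integral domains (commutative, unitary, without zero-divisors). A domain $D$ is called a sharp domain if whenever $I \supseteq AB$ with $I, A, B$ nonzero ideals of $D$, there exist ideals $A' \supseteq A$ and $B' \supseteq B$ of $D$ such that $I = A'B'$. A domain $D$ is of finite character if every nonzero element of $D$ is contained in only finitely many maximal ideals. The value group of a valuation domain ''is a complete subgroup of the reals'' means that it is isomorphic, as an ordered abelian group, to a subgroup of $(\mathbb{R},+)$ in which every nonempty subset bounded below has an infimum (in that subgroup); equivalently, it is order-isomorphic to $0$, $\mathbb{Z}$ or $\mathbb{R}$. A field is regarded as a valuation domain with trivial value group $0$. *)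

(* Defs.v *)
(* Ideals are classical [set]s because they need not be decidable. *)
From HB Require Import structures.
From mathcomp Require Import all_boot all_order all_algebra.
From mathcomp Require Import boolp classical_sets functions cardinality reals.

Set Implicit Arguments.
Unset Strict Implicit.
Unset Printing Implicit Defensive.

Import Order.TTheory GRing.Theory Num.Theory.

Local Open Scope classical_set_scope.
Local Open Scope ring_scope.

Section Ideals.
Variable D : idomainType.
Implicit Types I J A B M : set D.

(* Improper ideals are allowed, unlike in [idealr_closed] of ring_quotient. *)
Definition is_ideal I : Prop :=
  [/\ I 0,
      forall x y, I x -> I y -> I (x + y)
    & forall r x, I x -> I (r * x)].

Definition nonzero_ideal I : Prop := is_ideal I /\ I <> [set 0].

Definition ideal_mul A B : set D :=
  [set x | exists (n : nat) (a b : 'I_n -> D),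
     [/\ forall i, A (a i), forall i, B (b i) & x = \sum_(i < n) a i * b i]].

Definition maximal_ideal M : Prop :=
  [/\ is_ideal M, M <> setT
    & forall J, is_ideal J -> M `<=` J -> J = M \/ J = setT].

End Ideals.

Definition sharp_domain (D : idomainType) : Prop :=
  forall I A B : set D,
    nonzero_ideal I -> nonzero_ideal A -> nonzero_ideal B ->
    ideal_mul A B `<=` I ->
    exists A' B' : set D,
      [/\ is_ideal A', is_ideal B', A `<=` A', B `<=` B' & I = ideal_mul A' B'].

Definition finite_character (D : idomainType) : Prop :=
  forall x : D, x != 0 -> finite_set [set M : set D | maximal_ideal M /\ M x].

(* D_M, realized inside the fraction field of D. *)
Definition localization (D : idomainType) (M : set D) : set {fraction D} :=
  [set z | exists a s : D, ~ M s /\ z = tofrac a / tofrac s].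

Section Valuation.
Variables (K : fieldType) (V : set K).

(* V is a valuation domain with fraction field K. *)
Definition valuation_domain : Prop :=
  [/\ V 1,
      forall x y, V x -> V y -> V (x - y),
      forall x y, V x -> V y -> V (x * y)
    & forall x, x != 0 -> V x \/ V x^-1].

(* x != 0 is not redundant: 0^-1 = 0. *)
Definition units : set K := [set x | [/\ x != 0, V x & V x^-1]].

(* The value group is K^* / V^*; its elements are the cosets x V^*. *)
Definition value (x : K) : set K := [set x * u | u in units].

Definition value_group : set (set K) := [set value x | x in [set x | x != 0]].

(* The group law (written additively in the reals) is the product of cosets. *)
Definition value_mul (g h : set K) : set K :=
  [set z | exists x y, [/\ g x, h y & z = x * y]].

(* x V^* <= y V^* iff y / x lies in V. *)
Definition value_le (g h : set K) : Prop :=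
  exists x y, [/\ g x, h y & V (y / x)].

End Valuation.

Section RealSubgroups.
Variable R : realType.

Definition real_subgroup (G : set R) : Prop :=
  G 0 /\ forall x y, G x -> G y -> G (x - y).

(* Lower bounds and infima are taken in G, not in R. *)
Definition complete_in_itself (G : set R) : Prop :=
  forall S : set R, S `<=` G -> S !=set0 ->
    (exists2 b, G b & lbound S b) ->
    exists m, [/\ G m, lbound S m & forall b, G b -> lbound S b -> b <= m].

Definition value_group_complete_real (K : fieldType) (V : set K) : Prop :=
  exists (G : set R) (phi : set K -> R),
    [/\ real_subgroup G, complete_in_itself G,
        set_bij (value_group V) G phi,
        forall g h, value_group V g -> value_group V h ->
          phi (value_mul g h) = phi g + phi h
      & forall g h, value_group V g -> value_group V h ->
          value_le V g h <-> phi g <= phi h].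

End RealSubgroups.

(* Main.v *)
Require Import Defs.
From HB Require Import structures.
From mathcomp Require Import all_boot all_order all_algebra.
From mathcomp Require Import boolp classical_sets functions cardinality reals.
From mathcomp Require Import ring lra.

(** Given I containing AB, take A' = (I : B) and B' = (I : A'), the ideal
    quotients.  They contain A and B, and A'B' lies in I, for formal reasons;
    everything is in the inclusion I <= (I : B)(I : (I : B))
    ([residual_factorization]).

    This inclusion holds in D_M for every maximal ideal M
    ([local_residual_factorization]).  Write v for the real valuation at M and
    let x be in I.  When B is not inside I, completeness of the value group G
    gives an infimum beta in G of the values of B.  If v x is the least value
    on I, then x is a product of an element of value v x - beta and one of
    value beta; the first lies in (I : B), and the second in (I : (I : B)),
    because beta is the greatest lower bound of v(B).  If some y in I has
    v y < v x, an element b of B with v b - beta < v x - v y is available, and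
    x is, up to units of D_M, the product of b with an element of value
    v x - v b, which sends B above v y, hence into I.

    To return to D one needs ideal quotients to commute with localization.
    They do because, for every nonzero c in I and every M, some t outside M is
    divisible by c in all the D_N with N <> M ([separation]): by finite
    character only finitely many N matter, and for each of them a power of an
    element of N outside M has value at least that of c, the value group being
    archimedean.  Multiplication by t then carries a local quotient at M to a
    global one ([colon_saturation]). *)

Set Implicit Arguments.
Unset Strict Implicit.
Unset Printing Implicit Defensive.

Import Order.TTheory GRing.Theory Num.Theory.

Local Open Scope classical_set_scope.
Local Open Scope ring_scope.

(** * Ideals, quotients and the local-global principle *)

Section IdealArithmetic.
Variable D : idomainType.
Implicit Types (I J A B M N : set D) (a b c s t x y : D).

Definition colon I B : set D := [set a | forall b, B b -> I (a * b)].

(** This is the contraction to D of the extension of [I] to the localization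
    at [M]. *)
Definition saturation M I : set D := [set x | exists2 s, ~ M s & I (s * x)].

Lemma colon_ideal I B : is_ideal I -> is_ideal (colon I B).
Proof.
move=> [I0 ID IM]; split.
- by move=> b _; rewrite mul0r.
- by move=> x y Ix Iy b Bb; rewrite mulrDl; apply: ID; [exact: Ix|exact: Iy].
- by move=> r x Ix b Bb; rewrite -mulrA; apply/IM/Ix.
Qed.

Lemma mem_ideal_mul A B a b : A a -> B b -> ideal_mul A B (a * b).
Proof.
by move=> Aa Bb; exists 1%N, (fun=> a), (fun=> b); split; rewrite ?big_ord1.
Qed.

Lemma ideal_mul_ideal A B : is_ideal A -> is_ideal (ideal_mul A B).
Proof.
move=> [A0 AD AM]; split.
- exists 0%N, (fun=> 0), (fun=> 0).
  by split=> [|[]|] //; rewrite big_ord0.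
- move=> x y [n [a [b [Aa Bb ->]]]] [m [c [d [Ac Bd ->]]]].
  exists (n + m)%N.
  exists (fun i => match fintype.split i with inl j => a j | inr j => c j end).
  exists (fun i => match fintype.split i with inl j => b j | inr j => d j end).
  split=> [i|i|]; [by case: (fintype.split i)|by case: (fintype.split i)|].
  rewrite big_split_ord; congr (_ + _); apply: eq_bigr => i _.
  + by rewrite (unsplitK (inl i)).
  + by rewrite (unsplitK (inr i)).
- move=> r x [n [a [b [Aa Bb ->]]]].
  exists n, (fun i => r * a i), b; split=> // [i|]; first exact: AM.
  by rewrite mulr_sumr; apply: eq_bigr => i _; rewrite mulrA.
Qed.

Lemma ideal_mul_sub I A B :
  is_ideal I -> (forall a b, A a -> B b -> I (a * b)) -> ideal_mul A B `<=` I.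
Proof.
move=> [I0 ID _] ABI x [n [a [b [Aa Bb ->]]]].
by apply: (big_ind I) => // i _; exact: ABI.
Qed.

Lemma proper_ideal1 M : is_ideal M -> M <> setT -> ~ M 1.
Proof.
move=> [_ _ MM] Mp M1; apply: Mp; rewrite -subTset => x _.
by rewrite -(mulr1 x); exact: MM.
Qed.

(** Zorn's lemma is applied to the sets [X] whose union with [J] is a proper
    ideal, rather than to the proper ideals above [J], so that the empty chain
    also has an upper bound. *)
Lemma sub_maximal_ideal J : is_ideal J -> J <> setT ->
  exists2 M, maximal_ideal M & J `<=` M.
Proof.
move=> Jid /(proper_ideal1 Jid) J1.
pose P X := is_ideal (J `|` X) /\ ~ (J `|` X) 1.
have [F FP Ftot|X [[Xid X1] Xmax]] := @Zorn_bigcup D P.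
  split; last by case=> // -[X FX X1]; have [_] := FP X FX; apply; right.
  have [J0 JD JM] := Jid; split; first by left.
  - have inX X x y : F X -> (J `|` X) x -> (J `|` X) y ->
        (J `|` \bigcup_(X in F) X) (x + y).
      move=> FX xX yX; have [[_ XD _] _] := FP X FX.
      by have [?|?] := XD _ _ xX yX; [left|right; exists X].
    move=> x y [Jx|[X FX Xx]] [Jy|[Y FY Yy]].
    + by left; exact: JD.
    + by apply: (inX Y) => //; [left|right].
    + by apply: (inX X) => //; [right|left].
    + have [XY|YX] := Ftot X Y FX FY.
      * by apply: (inX Y) => //; right=> //; exact: XY.
      * by apply: (inX X) => //; right=> //; exact: YX.
  - move=> r x [Jx|[X FX Xx]]; first by left; exact: JM.
    have [[_ _ XM] _] := FP X FX.
    by have [?|?] := XM r x (or_intror Xx); [left|right; exists X].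
exists (J `|` X); last by left.
split=> // [JXT|K Kid JXK]; first by apply: X1; rewrite JXT.
have [->|KT] := pselect (K = setT); first by right.
left; apply/seteqP; split=> // x Kx; apply: contrapT => JXx.
have JK : J `|` K = K by apply/setUidPr => y Jy; apply: JXK; left.
apply: (Xmax K); last by rewrite /P JK; split=> //; exact: proper_ideal1.
split=> [|KX]; first by move=> y Xy; apply: JXK; right.
by apply: JXx; right; exact: KX.
Qed.

(** The denominators [s] with [s * x] in [I] form an ideal; being contained in
    no maximal ideal, it contains 1. *)
Lemma mem_ideal_local I x : is_ideal I ->
  (forall M, maximal_ideal M -> saturation M I x) -> I x.
Proof.
move=> [I0 ID IM] Ix; apply: contrapT => nIx.
pose J : set D := [set s | I (s * x)].
have Jid : is_ideal J.
  split; rewrite /J /=; first by rewrite mul0r.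
  - by move=> s t; rewrite mulrDl; exact: ID.
  - by move=> r s; rewrite -mulrA; exact: IM.
have [JT|M Mmax JM] := sub_maximal_ideal Jid.
  by apply: nIx; rewrite -(mul1r x); have : setT (1 : D) by []; rewrite -JT.
by have [s nMs /JM] := Ix M Mmax.
Qed.

Lemma sub_saturation M I : maximal_ideal M -> I `<=` saturation M I.
Proof.
by move=> [Mid Mp _] x Ix; exists 1; [exact: proper_ideal1|rewrite mul1r].
Qed.

End IdealArithmetic.

(** * From cosets of units to a real valuation on the domain *)

Section ValueGroup.
Variables (K : fieldType) (V : set K).
Hypothesis Vval : valuation_domain V.
Implicit Types x y : K.

Lemma value_refl x : value V x x.
Proof.
have [V1 _ _ _] := Vval; exists 1; last by rewrite mulr1.
by split; rewrite ?oner_neq0 ?invr1.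
Qed.

Lemma value_mulE x y : value_mul (value V x) (value V y) = value V (x * y).
Proof.
have [V1 _ VM _] := Vval; apply/seteqP; split=> z.
- move=> [_ [_ [[u [u0 Vu Vu'] <-] [w [w0 Vw Vw'] <-] ->]]].
  exists (u * w); last by ring.
  by split; rewrite ?mulf_neq0 ?invfM; auto.
- move=> [u uU <-]; exists x, (y * u); split; last by rewrite mulrA.
  + exact: value_refl.
  + by exists u.
Qed.

Lemma value_leE x y : x != 0 -> y != 0 ->
  value_le V (value V x) (value V y) <-> V (y / x).
Proof.
move=> x0 y0; have [V1 _ VM _] := Vval; split.
- move=> [_ [_ [[u [u0 Vu Vu'] <-] [w [w0 Vw Vw'] <-]]]] Vq.
  have -> : y / x = y * w / (x * u) * (u * w^-1) by field; rewrite ?u0 ?w0 ?x0.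
  by apply: (VM) => //; exact: VM.
- by move=> Vq; exists x, y; split=> //; exact: value_refl.
Qed.

Lemma value_group_value x : x != 0 -> value_group V (value V x).
Proof. by move=> x0; exists x. Qed.

End ValueGroup.

(** The valuation of the localization at [M], restricted to the domain so that
    no fraction appears later.  Since [v y - v x] is the value of the fraction
    y / x, the clause [lv_le] says that the localization is its valuation ring;
    the value of [v] at 0 is meaningless. *)
Record local_valuation (R : realType) (D : idomainType) (M : set D)
    (G : set R) (v : D -> R) : Prop := LocalValuation {
  lv_group : real_subgroup G;
  lv_complete : complete_in_itself G;
  lv_mem : forall x, x != 0 -> G (v x);
  lvM : forall x y, x != 0 -> y != 0 -> v (x * y) = v x + v y;
  lv_le : forall x y, x != 0 -> y != 0 ->
    v x <= v y <-> exists s r, ~ M s /\ s * y = r * x;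
  lv_onto : forall g, G g -> 0 <= g -> exists2 a, a != 0 & v a = g }.

Lemma exists_local_valuation (R : realType) (D : idomainType) (M : set D) :
  maximal_ideal M -> valuation_domain (localization M) ->
  value_group_complete_real R (localization M) ->
  exists (G : set R) (v : D -> R), local_valuation M G v.
Proof.
move=> [Mid Mp _] Vval [G [phi [Gsub Gcpl [phiG _ phi_onto] phiM phile]]].
have [M0 _ _] := Mid; have M1 := proper_ideal1 Mid Mp.
have s_neq0 s : ~ M s -> s != 0 by move=> Ms; apply/eqP => s0; rewrite s0 in Ms.
pose V := localization M.
have tf0 x : (tofrac x != 0) = (x != 0) :> bool by rewrite tofrac_eq0.
have vg (z : {fraction D}) : z != 0 -> value_group V (value V z).
  exact: value_group_value.
have le_phi (y z : {fraction D}) : y != 0 -> z != 0 ->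
    phi (value V y) <= phi (value V z) <-> V (z / y).
  by move=> y0 z0; rewrite -phile ?value_leE //; exact: vg.
exists G, (fun x => phi (value V (tofrac x))); split=> //.
- by move=> x x0; apply/phiG/vg; rewrite tf0.
- move=> x y x0 y0; rewrite tofracM -value_mulE //.
  by apply: phiM; apply: vg; rewrite tf0.
- move=> x y x0 y0; rewrite le_phi ?tf0 //; split.
  + move=> [r [s [Ms eq]]]; exists s, r; split=> //.
    have s0 := s_neq0 _ Ms.
    apply/eqP; rewrite -tofrac_eq !tofracM.
    by rewrite [X in X == _]mulrC -eqr_div ?tf0 // eq.
  + move=> [s [r [Ms eq]]]; exists r, s; split=> //.
    have s0 := s_neq0 _ Ms.
    by apply/eqP; rewrite eqr_div ?tf0 // -!tofracM mulrC eq.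
- move=> g Gg g0; have [_ [z /= z0 <-] phiz] := phi_onto g Gg.
  have phi1 : phi (value V 1) = 0.
    have := phiM _ _ (vg _ (oner_neq0 _)) (vg _ (oner_neq0 _)).
    by rewrite value_mulE // mulr1; lra.
  have [a [s [Ms zE]]] : V z.
    by rewrite -(divr1 z); apply/le_phi; rewrite ?oner_neq0 // phi1 phiz.
  have s0 := s_neq0 _ Ms.
  have a0 : a != 0 by rewrite -tf0; apply: contraNneq z0 => a0; rewrite zE a0 mul0r.
  exists a => //; rewrite -phiz; apply/eqP; rewrite eq_le; apply/andP.
  split; apply/le_phi; rewrite ?tf0 //; rewrite zE.
  + by exists 1, s; split=> //; rewrite tofrac1 mulrAC divff ?tf0.
  + by exists s, 1; split=> //; rewrite tofrac1 divr1 invf_div mulrC divfK ?tf0.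
Qed.

(** * Factorization over one localization *)

Section LocalValuation.
Variables (R : realType) (D : idomainType) (M : set D).
Variables (G : set R) (v : D -> R).
Hypotheses (Mmax : maximal_ideal M) (lv : local_valuation M G v).
Implicit Types (I A B : set D) (a b c s t x y : D).

Lemma notin_neq0 s : ~ M s -> s != 0.
Proof.
by have [[M0 _ _] _ _] := Mmax; move=> Ms; apply/eqP => s0; rewrite s0 in Ms.
Qed.

Lemma lv1 : v 1 = 0.
Proof.
by have := lvM lv (oner_neq0 D) (oner_neq0 D); rewrite mulr1; lra.
Qed.

Lemma lv_ge0 x : x != 0 -> 0 <= v x.
Proof.
move=> x0; rewrite -lv1; apply/(lv_le lv); rewrite ?oner_neq0 //.
exists 1, x; split; last by rewrite mul1r mulr1.
by have [Mid Mp _] := Mmax; exact: proper_ideal1.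
Qed.

Lemma lv_le0 x : x != 0 -> v x <= 0 <-> ~ M x.
Proof.
move=> x0; have [[_ _ MM] _ _] := Mmax.
rewrite -lv1; split.
- move/(lv_le lv x0 (oner_neq0 _)) => [s [r [Ms eq]]] Mx; apply: Ms.
  by rewrite -(mulr1 s) eq; exact: MM.
- by move=> Mx; apply/(lv_le lv); rewrite ?oner_neq0 //; exists x, 1; rewrite mulrC.
Qed.

Lemma notin_mul s t : ~ M s -> ~ M t -> ~ M (s * t).
Proof.
move=> Ms Mt; have [s0 t0] := (notin_neq0 Ms, notin_neq0 Mt).
apply/lv_le0; first by rewrite mulf_neq0.
rewrite (lvM lv) //.
by have [/(lv_le0 s0) + /(lv_le0 t0)] := (Ms, Mt); lra.
Qed.

Lemma notin_exp s n : ~ M s -> ~ M (s ^+ n).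
Proof.
move=> Ms; elim: n => [|n IHn]; last by rewrite exprS; exact: notin_mul.
by have [Mid Mp _] := Mmax; rewrite expr0; exact: proper_ideal1.
Qed.

Lemma lvX x n : x != 0 -> v (x ^+ n) = v x *+ n.
Proof.
move=> x0; elim: n => [|n IHn]; first by rewrite expr0 lv1.
by rewrite exprS (lvM lv) ?expf_neq0 // IHn mulrS.
Qed.

(** This is where the rank one of the valuation is used: an element of [M] has
    positive value, and the reals are archimedean. *)
Lemma lv_archimedean x y : M x -> x != 0 -> y != 0 ->
  exists n, v y <= v (x ^+ n).
Proof.
move=> Mx x0 y0.
have vx : 0 < v x by rewrite ltNge; apply/negP => /(lv_le0 x0).
exists (Num.bound (v y / v x)); rewrite lvX // -mulr_natl -ler_pdivrMr //.
by apply/ltW/archi_boundP; rewrite divr_ge0 ?lv_ge0.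
Qed.

Lemma saturation_up I x y : is_ideal I -> x != 0 -> y != 0 ->
  saturation M I x -> v x <= v y -> saturation M I y.
Proof.
move=> [_ _ IM] x0 y0 [s Ms Isx] /(lv_le lv x0 y0) [t [r [Mt eq]]].
exists (s * t); first exact: notin_mul.
by rewrite -mulrA eq mulrCA; exact: IM.
Qed.

Lemma saturation0 I : is_ideal I -> saturation M I 0.
Proof. by case=> I0 _ _; apply: sub_saturation. Qed.

(** The product [a * b] need only have value at most [v x]: then [x] is a
    multiple of it in the localization.  The two ideals cannot simply be
    compared with principal ones, because [I] and [B] may each fail to attain
    its infimum; whether [x] has least value in [I] decides which of the two
    factors is chosen first. *)
Lemma local_residual_factorization I B x : is_ideal I ->
  saturation M I x -> x != 0 ->
  exists a b, [/\ a != 0, b != 0, colon (saturation M I) B a,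
    colon (saturation M I) (colon (saturation M I) B) b & v (a * b) <= v x].
Proof.
move=> Iid Ux x0; set U := saturation M I.
have U0 : U 0 by exact: saturation0.
have Uup y z : y != 0 -> U y -> (z != 0 -> v y <= v z) -> U z.
  move=> y0 Uy yz; have [->//|z0] := eqVneq z 0.
  exact: saturation_up (yz z0).
(* In this case the first quotient is the whole ring. *)
have [BU|nBU] := pselect (B `<=` U).
  exists 1, x; split; rewrite ?oner_neq0 ?mul1r //.
    by move=> c Bc; rewrite mul1r; exact: BU.
  move=> a _; have [->|a0] := eqVneq a 0; first by rewrite mulr0.
  apply: (Uup x) => // _; rewrite (lvM lv) //.
  by have := lv_ge0 a0; lra.
have [b0 [Bb0 nUb0]] : exists b0, B b0 /\ ~ U b0.
  by apply: contrapT => nb; apply: nBU => c Bc; apply: contrapT => ?; apply: nb; exists c.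
have b00 : b0 != 0 by apply/eqP => b00; apply: nUb0; rewrite b00.
have vb0 : v b0 < v x.
  by rewrite ltNge; apply/negP => vxb; apply: nUb0; exact: (Uup x).
have [G0 GB] := lv_group lv.
have GD g h : G g -> G h -> G (g + h).
  by move=> Gg Gh; rewrite -(opprK h) -(sub0r h); exact/GB/GB.
pose S := v @` [set c | B c /\ c != 0].
have [beta [Gbeta Sbeta beta_max]] :
    exists m, [/\ G m, lbound S m & forall g, G g -> lbound S g -> g <= m].
  apply: (lv_complete lv).
  - by move=> _ [c [_ c0] <-]; exact: (lv_mem lv).
  - by exists (v b0), b0.
  - by exists 0 => // _ [c [_ c0] <-]; exact: lv_ge0.
have leS c : B c -> c != 0 -> beta <= v c by move=> Bc c0; apply: Sbeta; exists c.
have beta0 : 0 <= beta.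
  by apply: beta_max => // _ [c [_ c0] <-]; exact: lv_ge0.
have Gx := lv_mem lv x0.
have [[y [Uy y0 vy]]|xmin] := pselect (exists y, [/\ U y, y != 0 & v y < v x]).
- have Gy := lv_mem lv y0.
  (* Here b1 is close enough to beta for x / b1 to carry B above y; keeping
     its value at most that of b0, which is outside U, makes x / b1 integral. *)
  have [b1 [Bb1 b10 vb1 vb1x]] :
      exists b1, [/\ B b1, b1 != 0, v b1 < beta + (v x - v y) & v b1 < v x].
    have [b2 [Bb2 b20 vb2]] :
        exists b2, [/\ B b2, b2 != 0 & v b2 < beta + (v x - v y)].
      apply: contrapT => nb.
      suff : beta + (v x - v y) <= beta by lra.
      apply: beta_max; first by apply: GD => //; exact: GB.
      move=> _ [c [Bc c0] <-]; rewrite leNgt; apply/negP => vc.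
      by apply: nb; exists c.
    have [vb20|vb02] := lerP (v b2) (v b0).
    + by exists b2; split=> //; lra.
    + by exists b0; split=> //; lra.
  have [a a0 va] : exists2 a, a != 0 & v a = v x - v b1.
    by apply: (lv_onto lv); [apply: GB => //; exact: (lv_mem lv)|lra].
  exists a, b1; split=> //.
  + move=> c Bc; have [->|c0] := eqVneq c 0; first by rewrite mulr0.
    apply: (Uup y) => // _; rewrite (lvM lv) //.
    by have := leS c Bc c0; lra.
  + by move=> a' Qa'; rewrite mulrC; exact: Qa'.
  + by rewrite (lvM lv) //; lra.
- have {}xmin y : U y -> y != 0 -> v x <= v y.
    by move=> Uy y0; rewrite leNgt; apply/negP => vy; apply: xmin; exists y.
  (* U is the principal ideal of x, so the quotients are generated by elements
     of values v x - beta and beta, even if B does not attain beta. *)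
  have [p p0 vp] := lv_onto lv Gbeta beta0.
  have [a a0 va] : exists2 a, a != 0 & v a = v x - beta.
    apply: (lv_onto lv); first exact: GB.
    by have := leS b0 Bb0 b00; lra.
  exists a, p; split=> //.
  + move=> c Bc; have [->|c0] := eqVneq c 0; first by rewrite mulr0.
    apply: (Uup x) => // _; rewrite (lvM lv) //.
    by have := leS c Bc c0; lra.
  + move=> a' Qa'; have [->|a'0] := eqVneq a' 0; first by rewrite mulr0.
    apply: (Uup x) => // _; rewrite (lvM lv) // vp.
    suff : v x - v a' <= beta by lra.
    apply: beta_max; first by apply: GB => //; exact: (lv_mem lv).
    move=> _ [c [Bc c0] <-].
    have := xmin _ (Qa' c Bc) (mulf_neq0 a'0 c0); rewrite (lvM lv) //; lra.
  + by rewrite (lvM lv) // vp; lra.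
Qed.

End LocalValuation.

(** * Passing from the localizations to the domain *)

Section Globalization.
Variables (R : realType) (D : idomainType).
Hypothesis fin : finite_character D.
Hypothesis val : forall M : set D, maximal_ideal M ->
  exists (G : set R) (v : D -> R), local_valuation M G v.
Implicit Types (I A B M N : set D) (a b c s t x y : D).

(** An element of [N] outside [M] becomes, after raising it to a high power,
    a multiple of [c] at [N], and it stays a unit at [M]. *)
Lemma separation_one M N c : maximal_ideal M -> maximal_ideal N -> N <> M ->
  c != 0 -> exists2 t, ~ M t & exists s r, ~ N s /\ s * t = r * c.
Proof.
move=> Mmax Nmax NM c0.
have [G [v lv]] := val Mmax; have [H [w lw]] := val Nmax.
have [t0 [Nt0 Mt0]] : exists t, N t /\ ~ M t.
  apply: contrapT => nt.
  have NsubM : N `<=` M.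
    by move=> t Nt; apply: contrapT => Mt; apply: nt; exists t.
  have [Mid Mp _] := Mmax; have [_ _ /(_ M Mid NsubM)] := Nmax.
  by case=> // /esym.
have t00 : t0 != 0 := notin_neq0 Mmax Mt0.
have [n vn] := lv_archimedean Nmax lw Nt0 t00 c0.
exists (t0 ^+ n); first exact: (notin_exp Mmax lv).
by apply/(lv_le lw) => //; rewrite expf_neq0.
Qed.

(** Only the finitely many maximal ideals containing [c] impose a condition;
    the product of the elements obtained for each of them works, as the
    complement of [M] is multiplicatively closed. *)
Lemma separation M c : maximal_ideal M -> c != 0 ->
  exists2 t, ~ M t & forall N, maximal_ideal N -> N <> M ->
    exists s r, ~ N s /\ s * t = r * c.
Proof.
move=> Mmax c0; have [G [v lv]] := val Mmax.
have [l lE] := (finite_seqP _).1 (fin c0).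
suff [t Mt tP] : exists2 t, ~ M t &
    forall N, N \in l -> maximal_ideal N -> N <> M ->
    exists s r, ~ N s /\ s * t = r * c.
  exists t => // N Nmax NM; have [Nl|Nl] := boolP (N \in l); first exact: tP.
  exists c, t; split; last by rewrite mulrC.
  move=> Nc; move/negP: Nl; apply.
  have : [set` l] N by rewrite -lE.
  by [].
elim: (l) => [|N0 l' [t Mt tP]].
  by exists 1 => //; have [Mid Mp _] := Mmax; exact: proper_ideal1.
have [[N0max N0M]|nN0] := pselect (maximal_ideal N0 /\ N0 <> M); last first.
  exists t => // N; rewrite inE => /orP[/eqP-> Nmax NM|]; last exact: tP.
  by case: nN0.
have [u Mu [s [r [Ns eq]]]] := separation_one Mmax N0max N0M c0.
exists (t * u); first exact: (notin_mul Mmax lv).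
move=> N; rewrite inE => /orP[/eqP-> _ _|Nl Nmax NM].
  by exists s, (t * r); split=> //; rewrite mulrCA eq mulrA.
have [s' [r' [Ns' eq']]] := tP N Nl Nmax NM.
by exists s', (u * r'); split=> //; rewrite mulrA eq' mulrC mulrA.
Qed.

(** Localization commutes with ideal quotients.  A priori the denominator [s]
    with [s * a * b] in [I] depends on [b]; an element [t] separating [M] from
    the other maximal ideals, for some nonzero [c] in [I], serves all [b] at
    once, since at the other maximal ideals [t] is already a multiple of
    [c]. *)
Lemma colon_saturation M I B a : maximal_ideal M -> nonzero_ideal I ->
  colon (saturation M I) B a -> saturation M (colon I B) a.
Proof.
move=> Mmax [Iid In0] aB; have [I0 _ IM] := Iid.
have [c [Ic c0]] : exists c, I c /\ c != 0.
  apply: contrapT => nc; apply: In0; apply/seteqP; split=> [x Ix|_ ->//].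
  by apply: contrapT => /eqP x0; apply: nc; exists x.
have [t Mt tP] := separation Mmax c0.
exists t => // b Bb; apply: mem_ideal_local => // N Nmax.
have [->|NM] := pselect (N = M).
  have [s Ms Isab] := aB b Bb; exists s => //.
  by rewrite -mulrA mulrCA; exact: IM.
have [s [r [Ns eq]]] := tP N Nmax NM; exists s => //.
have -> : s * (t * a * b) = a * b * r * c by ring: eq.
exact: IM.
Qed.

Lemma residual_factorization I B : nonzero_ideal I ->
  I = ideal_mul (colon I B) (colon I (colon I B)).
Proof.
move=> Inz; have [Iid _] := Inz; have [I0 _ IM] := Iid.
have Qid := colon_ideal B Iid.
have Pid := ideal_mul_ideal (colon I (colon I B)) Qid.
apply/seteqP; split=> [x Ix|]; last first.
  by apply: ideal_mul_sub => // a b Qa Pb; rewrite mulrC; exact: Pb.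
have [->|x0] := eqVneq x 0; first by case: Pid.
apply: mem_ideal_local => // M Mmax; have [G [v lv]] := val Mmax.
have Ux := sub_saturation Mmax Ix.
have [a [b [a0 b0 Qa Pb ab]]] :=
  local_residual_factorization Mmax lv B Iid Ux x0.
have [t Mt Qta] := colon_saturation Mmax Inz Qa.
have [u Mu Pub] : saturation M (colon I (colon I B)) b.
  apply: colon_saturation => // a' Qa'; apply: Pb => c Bc.
  exact/(sub_saturation Mmax)/Qa'.
have [s [r [Ms eq]]] := (lv_le lv (mulf_neq0 a0 b0) x0).1 ab.
exists (t * u * s); first by do !apply: (notin_mul Mmax lv).
have -> : t * u * s * x = r * ((t * a) * (u * b)) by ring: eq.
by case: Pid => _ _; apply; exact: mem_ideal_mul.
Qed.

End Globalization.

Theorem theorem15 (R : realType) (D : idomainType)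
  (finite_char : finite_character D)
  (valuation_loc : forall M : set D, maximal_ideal M ->
     valuation_domain (localization M) /\
     value_group_complete_real R (localization M)) :
  sharp_domain D.
Proof.
have lv M : maximal_ideal M ->
    exists (G : set R) (v : D -> R), local_valuation M G v.
  move=> Mmax; have [Vval Vreal] := valuation_loc M Mmax.
  exact: exists_local_valuation.
move=> I A B Inz _ _ ABI; have [Iid _] := Inz.
exists (colon I B), (colon I (colon I B)); split.
- exact: colon_ideal.
- exact: colon_ideal.
- by move=> a Aa b Bb; apply/ABI/mem_ideal_mul.
- by move=> b Bb a Qa; rewrite mulrC; exact: Qa.
- exact: (residual_factorization finite_char lv).
Qed.
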